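(* For any $n \geq 0$, the map $\chi$ from the set $\mathsf{TID}(n)$ of Tamari interval diagrams of size $n$ to the set $\mathsf{IP}(n)$ of interval-posets of size $n$ is a bijection.
   Context: For integers $i,j$, $[i,j]=\{i,i+1,\dots,j\}$ and $[i]=[1,i]$. The $i$-th letter of a word $u$ is $u_i$. A Tamari diagram of size $n$ is a word $u$ of length $n$ on $\mathbb{N}=\{0,1,2,\dots\}$ such that (i) $0\leq u_i\leq n-i$ for all $i\in[n]$, and (ii) $u_{i+j}\leq u_i-j$ for all $i\in[n]$ and $j\in[0,u_i]$. A dual Tamari diagram of size $n$ is a word $v$ of length $n$ on $\mathbb{N}$ such that (i) $0\leq v_i\leq i-1$ for all $i\in[n]$, and (ii) $v_{i-j}\leq v_i-j$ for all $i\in[n]$ and $j\in[0,v_i]$. A Tamari diagram $u$ and a dual Tamari diagram $v$, both of size $n$, are compatible if there are no $i,j$ with $1\leq i<j\leq n$ such that $u_i\geq j-i$ and $v_j\geq j-i$. A Tamari interval diagram of size $n$ is a pair $(u,v)$ consisting of a Tamari diagram $u$ and a dual Tamari diagram $v$, both of size $n$, that are compatible; $\mathsf{TID}(n)$ is the set of these. An interval-poset of size $n$ is a (reflexive) partial order $\lhd$ on a set of $n$ symbols $\{\pi_1,\dots,\pi_n\}$ such that: (i) if $i<k$ and $\pi_k\lhd\pi_i$, then $\pi_j\lhd\pi_i$ for all $j$ with $i<j<k$; (ii) if $i<k$ and $\pi_i\lhd\pi_k$, then $\pi_j\lhd\pi_k$ for all $j$ with $i<j<k$. $\mathsf{IP}(n)$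 is the set of interval-posets of size $n$. The map $\chi$ sends $(u,v)\in\mathsf{TID}(n)$ to the relation $\lhd$ on $\{\pi_1,\dots,\pi_n\}$ consisting exactly of the relations $\pi_{i+l}\lhd\pi_i$ for all $i\in[n]$ and $0\leq l\leq u_i$, and $\pi_{i-k}\lhd\pi_i$ for all $i\in[n]$ and $0\leq k\leq v_i$. *)

(* Defs.v *)
From mathcomp Require Import all_boot.
From mathcomp Require Import boolp classical_sets functions.

Set Implicit Arguments.
Unset Strict Implicit.
Unset Printing Implicit Defensive.

(* Letters are numbered from 1, so only positions 1 <= i <= size u are
   meaningful. *)
Definition letter (u : seq nat) (i : nat) : nat := nth 0 u i.-1.

Definition tamari_diagram (n : nat) (u : n.-tuple nat) : Prop :=
  (forall i, 1 <= i <= n -> letter u i <= n - i) /\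
  (forall i j, 1 <= i <= n -> j <= letter u i ->
     letter u (i + j) <= letter u i - j).

Definition dual_tamari_diagram (n : nat) (v : n.-tuple nat) : Prop :=
  (forall i, 1 <= i <= n -> letter v i <= i - 1) /\
  (forall i j, 1 <= i <= n -> j <= letter v i ->
     letter v (i - j) <= letter v i - j).

Definition compatible (n : nat) (u v : n.-tuple nat) : Prop :=
  ~ exists i j, [/\ 1 <= i, i < j, j <= n,
                    j - i <= letter u i & j - i <= letter v j].

Definition TID (n : nat) : set (n.-tuple nat * n.-tuple nat) :=
  [set uv | [/\ tamari_diagram uv.1, dual_tamari_diagram uv.2 &
                compatible uv.1 uv.2]]%classic.
Arguments TID : clear implicits.

(* The symbol pi_i is represented by the ordinal i - 1 of 'I_n, and r x y
   stands for x <| y. *)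
Definition interval_poset (n : nat) (r : rel 'I_n) : Prop :=
  [/\ reflexive r, antisymmetric r, transitive r,
      (forall i k : 'I_n, i < k -> r k i ->
         forall j : 'I_n, i < j < k -> r j i) &
      (forall i k : 'I_n, i < k -> r i k ->
         forall j : 'I_n, i < j < k -> r j k)].

Definition IP (n : nat) : set (rel 'I_n) := [set r | interval_poset r]%classic.
Arguments IP : clear implicits.

(* The label of the symbol x is x.+1. As labels are positive, the truncation
   of i - k never creates a spurious relation. *)
Definition chi (n : nat) (uv : n.-tuple nat * n.-tuple nat) : rel 'I_n :=
  fun x y =>
    `[< (exists i l, [/\ 1 <= i <= n, l <= letter uv.1 i,
                         x.+1 = i + l & y.+1 = i])
     \/ (exists i k, [/\ 1 <= i <= n, k <= letter uv.2 i,
                         x.+1 = i - k & y.+1 = i]) >].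
Arguments chi : clear implicits.

(* Main.v *)
Require Import Defs.
From mathcomp Require Import all_boot.
From mathcomp Require Import boolp classical_sets functions.
From mathcomp Require Import zify.

(** Number the symbols from 0, and let [a y], [b y] be the letters at position
    [y] of the Tamari diagram and of the dual one.  The map [chi] makes the
    principal ideal of [y] the integer interval from [y - b y] to [y + a y]
    ([chiE]), so everything is a statement about these intervals.

    The two closure conditions of an interval-poset say precisely that every
    principal ideal is an integer interval around its generator.  Such a family
    of intervals is thus the same thing as a pair of words bounded as in
    condition (i) of the diagrams, and it remains to match the other axioms.
    Compatibility is antisymmetry: it forbids [x < y] to lie in each other's
    intervals.  Condition (ii) of the diagrams says that the right end of the
    interval of [y] bounds the right ends of all points between [y] and it, and
    likewise on the left.  This is a fragment of transitivity, and together with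
    antisymmetry it gives all of it: when [x] is below [y], [y] is below [z] and
    the two steps go in opposite directions, either [x] falls between [y] and
    [z], or the second step is undone by the first, so that [y = z]
    ([chi_interval_poset]).

    A word is recovered from the relation because its letters measure the
    intervals ([chi_inj]); conversely, an interval-poset comes from the words
    whose letters are the distances from [y] to the farthest elements of its
    ideal on each side ([le_right_reachE], [le_left_reachE]). *)

(** * Diagrams in terms of interval ends *)

Lemma letter_tnth {n} (u : n.-tuple nat) (y : 'I_n) : letter u y.+1 = tnth u y.
Proof. by rewrite (tnth_nth 0). Qed.

(** The natural quantity is the right end [y + tnth u y]: both conditions are
    inequalities between such ends, without subtraction. *)
Lemma tamari_diagramP n (u : n.-tuple nat) :
  tamari_diagram u <->
  (forall y : 'I_n, y + tnth u y < n) /\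
  (forall y z : 'I_n, y <= z <= y + tnth u y ->
     z + tnth u z <= y + tnth u y).
Proof.
split=> -[bound nest].
  split=> [y|y z yz].
    have := bound y.+1; rewrite letter_tnth; have := ltn_ord y; lia.
  have := nest y.+1 (z - y); rewrite letter_tnth.
  have -> : y.+1 + (z - y) = z.+1 by lia.
  rewrite letter_tnth; have := ltn_ord y; lia.
split=> [[|i] // lt_in|[|i] // j lt_in].
  have := bound (Ordinal lt_in); rewrite -letter_tnth /=; lia.
have := bound (Ordinal lt_in); rewrite -letter_tnth /= => bound_i le_j.
have lt_ij : i + j < n by lia.
have := nest (Ordinal lt_in) (Ordinal lt_ij).
rewrite -!letter_tnth /= addSn; lia.
Qed.

(** Comparing the left ends [y - tnth v y] and [z - tnth v z] is written
    additively, so that no truncation can occur. *)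
Lemma dual_tamari_diagramP n (v : n.-tuple nat) :
  dual_tamari_diagram v <->
  (forall y : 'I_n, tnth v y <= y) /\
  (forall y z : 'I_n, z <= y <= z + tnth v y ->
     y + tnth v z <= z + tnth v y).
Proof.
split=> -[bound nest].
  split=> [y|y z zy].
    have := bound y.+1; rewrite letter_tnth; have := ltn_ord y; lia.
  have := nest y.+1 (y - z); rewrite letter_tnth.
  have -> : y.+1 - (y - z) = z.+1 by lia.
  rewrite letter_tnth; have := ltn_ord y; lia.
split=> [[|i] // lt_in|[|i] // j lt_in].
  have := bound (Ordinal lt_in); rewrite -letter_tnth /=; lia.
have := bound (Ordinal lt_in); rewrite -letter_tnth /= => bound_i le_j.
have lt_ij : i - j < n by lia.
have := nest (Ordinal lt_in) (Ordinal lt_ij).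
rewrite -!letter_tnth /= subSn; lia.
Qed.

Lemma compatibleP n (u v : n.-tuple nat) :
  compatible u v <->
  (forall x y : 'I_n, x < y -> y <= x + tnth u x -> y <= x + tnth v y -> False).
Proof.
split=> [compat x y lt_xy le_u le_v | compat [[|i] [[|j] [//= _]]] // lt_ij].
  apply: compat; exists x.+1, y.+1; rewrite !letter_tnth.
  by split; have := ltn_ord y; lia.
move=> lt_jn; have lt_in : i < n by lia.
have := compat (Ordinal lt_in) (Ordinal lt_jn).
rewrite -!letter_tnth /=; lia.
Qed.

(** * From diagrams to interval-posets *)

Lemma chiE n (uv : n.-tuple nat * n.-tuple nat) (x y : 'I_n) :
  (forall z : 'I_n, tnth uv.2 z <= z) ->
  chi n uv x y = (y <= x <= y + tnth uv.1 y) || (x <= y <= x + tnth uv.2 y).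
Proof.
move=> bound; apply/asboolP/idP => [[] [i [l [_ + + ei]]] | /orP[] xy].
- rewrite -ei letter_tnth; lia.
- rewrite -ei letter_tnth; have := bound y; lia.
- left; exists y.+1, (x - y); rewrite letter_tnth.
  by split; have := ltn_ord y; lia.
- right; exists y.+1, (y - x); rewrite letter_tnth.
  by split; have := ltn_ord y; lia.
Qed.

Lemma chi_interval_poset n (uv : n.-tuple nat * n.-tuple nat) :
  TID n uv -> IP n (chi n uv).
Proof.
case=> /tamari_diagramP[_ nestu] /dual_tamari_diagramP[boundv nestv].
move=> /compatibleP compat; set r := chi n uv.
have rE x y : r x y =
    (y <= x <= y + tnth uv.1 y) || (x <= y <= x + tnth uv.2 y).
  exact: chiE.
have asym : antisymmetric r.
  move=> x y /andP[]; rewrite !rE => xy yx; apply/val_inj => /=.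
  by have := compat x y; have := compat y x; lia.
split=> //.
- by move=> x; rewrite rE; lia.
- move=> y x z xy yz.
  have := nestu z y; have := nestv z y.
  have [zy|nzy] := boolP (r z y).
    (* The second step is undone. *)
    by have -> : z = y by apply: asym; rewrite zy yz.
  move: xy yz nzy; rewrite !rE; lia.
- by move=> i k lt_ik + j; rewrite !rE; lia.
- by move=> i k lt_ik + j; rewrite !rE; lia.
Qed.

(** The farthest point of an ideal on one side, at distance [tnth uv.1 y], has
    to be in the ideal given by the other diagram, which bounds the letters of
    one diagram by those of the other.  Both diagrams play the same role, so an
    inequality suffices. *)
Lemma chi_inj n : set_inj (TID n) (chi n).
Proof.
have chi_mono uv uv' : TID n uv -> TID n uv' -> chi n uv = chi n uv' ->
    forall y : 'I_n, tnth uv.1 y <= tnth uv'.1 y /\ tnth uv.2 y <= tnth uv'.2 y.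
  case=> /tamari_diagramP[boundu _] /dual_tamari_diagramP[boundv _] _.
  case=> _ /dual_tamari_diagramP[boundv' _] _ eq_chi y.
  have mono x : chi n uv x y -> chi n uv' x y by rewrite eq_chi.
  have lt_ln : y - tnth uv.2 y < n by have := ltn_ord y; lia.
  have := mono (Ordinal (boundu y)); have := mono (Ordinal lt_ln).
  by rewrite !chiE //=; have := boundv y; lia.
move=> uv uv' /set_mem T /set_mem T' eq_chi.
have le y := chi_mono _ _ T T' eq_chi y.
have ge y := chi_mono _ _ T' T (esym eq_chi) y.
rewrite [uv]surjective_pairing [uv']surjective_pairing.
by congr pair; apply: eq_from_tnth => y; have := le y; have := ge y; lia.
Qed.

(** * From interval-posets to diagrams *)

(** Truncated subtraction makes the elements on the other side of [y] count
    for 0, so the maximum can run over the whole principal ideal. *)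
Definition right_reach {n} (r : rel 'I_n) (y : 'I_n) :=
  \max_(x | r x y) (x - y).
Definition left_reach {n} (r : rel 'I_n) (y : 'I_n) :=
  \max_(x | r x y) (y - x).

(** The maximum is attained, and the first closure condition fills the gap up
    to the element that attains it. *)
Lemma le_right_reachE {n} {r : rel 'I_n} (x y : 'I_n) :
  interval_poset r -> y <= x -> (x <= y + right_reach r y) = r x y.
Proof.
case=> refl _ _ fill _ le_yx; apply/idP/idP => [le_x | rxy]; last first.
  have : x - y <= right_reach r y by exact: bigmax_sup rxy _.
  lia.
have [] := @eq_bigmax_cond _ [pred x | r x y] (fun x => x - y).
  by apply/card_gt0P; exists y; apply: refl.
move=> m rmy reachE; rewrite /right_reach reachE in le_x.
have [/val_inj -> //|ne_yx] := eqVneq (val x) (val y).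
have [/val_inj -> //|ne_mx] := eqVneq (val x) (val m).
by apply: (fill y m) => //; move: ne_yx ne_mx => /=; lia.
Qed.

Lemma le_left_reachE {n} {r : rel 'I_n} (x y : 'I_n) :
  interval_poset r -> x <= y -> (y <= x + left_reach r y) = r x y.
Proof.
case=> refl _ _ _ fill le_xy; apply/idP/idP => [le_y | rxy]; last first.
  have : y - x <= left_reach r y by exact: bigmax_sup rxy _.
  lia.
have [] := @eq_bigmax_cond _ [pred x | r x y] (fun x => y - x).
  by apply/card_gt0P; exists y; apply: refl.
move=> m rmy reachE; rewrite /left_reach reachE in le_y.
have [/val_inj -> //|ne_yx] := eqVneq (val x) (val y).
have [/val_inj -> //|ne_mx] := eqVneq (val x) (val m).
by apply: (fill m y) => //; move: ne_yx ne_mx => /=; lia.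
Qed.

Lemma right_reach_bound {n} (r : rel 'I_n) (y : 'I_n) : y + right_reach r y < n.
Proof.
suff : right_reach r y <= n.-1 - y by have := ltn_ord y; lia.
by apply/bigmax_leqP => x _; have := ltn_ord x; lia.
Qed.

Lemma left_reach_bound {n} (r : rel 'I_n) (y : 'I_n) : left_reach r y <= y.
Proof. by apply/bigmax_leqP => x _; lia. Qed.

Definition reach_diagrams {n} (r : rel 'I_n) : n.-tuple nat * n.-tuple nat :=
  ([tuple right_reach r y | y < n], [tuple left_reach r y | y < n]).

(** Nesting is transitivity applied to the end of the inner interval. *)
Lemma reach_diagrams_TID {n} {r : rel 'I_n} :
  interval_poset r -> TID n (reach_diagrams r).
Proof.
move=> ipr; have [_ asym trans _ _] := ipr.
split.
- apply/tamari_diagramP; split=> [y|y z]; rewrite !tnth_mktuple.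
    exact: right_reach_bound.
  case/andP=> le_yz; rewrite le_right_reachE // => rzy.
  pose w := Ordinal (right_reach_bound r z).
  have rwz : r w z by rewrite -le_right_reachE //= leq_addr.
  have := trans _ _ _ rwz rzy.
  by rewrite -le_right_reachE //= (leq_trans le_yz) // leq_addr.
- apply/dual_tamari_diagramP; split=> [y|y z]; rewrite !tnth_mktuple.
    exact: left_reach_bound.
  case/andP=> le_zy; rewrite le_left_reachE // => rzy.
  have lt_wn : z - left_reach r z < n by have := ltn_ord z; lia.
  pose w := Ordinal lt_wn; have wE : w = z - left_reach r z :> nat by [].
  have le_reach := left_reach_bound r z.
  have rwz : r w z by rewrite -(le_left_reachE _ _ ipr); lia.
  have := trans _ _ _ rwz rzy.
  by rewrite -(le_left_reachE _ _ ipr); lia.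
- apply/compatibleP => x y lt_xy; rewrite !tnth_mktuple.
  rewrite le_right_reachE ?le_left_reachE 1?ltnW // => ryx rxy.
  have eq_xy : x = y by apply: asym; rewrite rxy ryx.
  by rewrite eq_xy ltnn in lt_xy.
Qed.

Lemma chi_reach_diagrams {n} {r : rel 'I_n} :
  interval_poset r -> chi n (reach_diagrams r) = r.
Proof.
move=> ipr; apply/funext => x; apply/funext => y.
rewrite chiE => [|z]; rewrite !tnth_mktuple; last exact: left_reach_bound.
case: (ltngtP x y) => [lt_xy|lt_yx|/val_inj ->] /=.
- by rewrite le_left_reachE // ltnW.
- by rewrite le_right_reachE ?orbF // ltnW.
- by have [-> _ _ _ _] := ipr; rewrite leq_addr.
Qed.

Theorem theorem2p2p3 (n : nat) : set_bij (TID n) (IP n) (chi n).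
Proof.
split; [exact: chi_interval_poset | exact: chi_inj | move=> r ipr].
exists (reach_diagrams r); first exact: reach_diagrams_TID.
exact: chi_reach_diagrams.
Qed.
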